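(* Let $\mathbf{A}$ be the matrix of a linear operator $A:\mathbb{R}^n\rightarrow\mathbb{R}^n$, and let its $j$th compound matrix $\mathbf{A}^{(j)}$ be $\mathcal{J}$-sign-symmetric primitive for every odd $j$ with $1\leq j\leq n$. Then the algebraic multiplicity $m(\lambda)$ of any eigenvalue $\lambda$ of $A$ is not greater than $2$. Let $\lambda_1,\ldots,\lambda_n$ be the (complex) eigenvalues of $A$, repeated according to algebraic multiplicity and numbered in order of non-increasing modulus. Then $$\rho(A)=|\lambda_1|>|\lambda_2|\geq|\lambda_3|>|\lambda_4|\geq\ldots,$$ that is, $|\lambda_i|>|\lambda_{i+1}|$ for every odd $i$ with $i+1\le n$. Moreover, $\lambda_1=\rho(A)$ is a simple positive eigenvalue of $A$. If $n$ is even, then $\lambda_n$ is real. For every pair $\lambda_i,\lambda_{i+1}$ with $i=2,4,6,\ldots$ and $i+1\le n$, one has $\arg(\lambda_{i+1})=-\arg(\lambda_i)$ (modulo $2\pi$).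
   Context: $\rho(A)$ denotes the spectral radius of $A$. The $j$th compound matrix $\mathbf{A}^{(j)}$ of an $n\times n$ real matrix $\mathbf{A}$ is the $C_n^j\times C_n^j$ matrix ($C_n^j=\frac{n!}{j!(n-j)!}$) of all minors of order $j$ of $\mathbf{A}$, with rows $i_1<\ldots<i_j$ and columns $k_1<\ldots<k_j$, numbered in lexicographic order; in particular $\mathbf{A}^{(1)}=\mathbf{A}$. Let $\mathbf{B}=\{b_{ij}\}$ be a real $N\times N$ matrix. $\mathbf{B}$ is strictly $\mathcal{J}$-sign-symmetric if it contains no zero elements and there exists a subset $\mathcal{J}\subseteq\{1,\ldots,N\}$ such that $b_{ij}<0$ if and only if one of the numbers $i,j$ belongs to $\mathcal{J}$ and the other belongs to $\{1,\ldots,N\}\setminus\mathcal{J}$. $\mathbf{B}$ is $\mathcal{J}$-sign-symmetric if there exists a subset $\mathcal{J}\subseteq\{1,\ldots,N\}$ such that: (a) $b_{ij}\le 0$ whenever one of $i,j$ belongs to $\mathcal{J}$ and the other to $\{1,\ldots,N\}\setminus\mathcal{J}$; (b) $b_{ij}<0$ implies that one of $i,j$ belongs to $\mathcal{J}$ and the other to $\{1,\ldots,N\}\setminus\mathcal{J}$. $\mathbf{B}$ is $\mathcal{J}$-sign-symmetric primitive if $\mathbf{B}$ is $\mathcal{J}$-sign-symmetric and $\mathbf{B}^m$ is strictly $\mathcal{J}$-sign-symmetric for some natural number $m\ge 1$. The subset $\mathcal{J}$ is not fixed in advance: it is part of the existence statement for each matrix and may be different for different compound matrices. *)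

(* Defs.v *)
From mathcomp Require Import all_boot all_order all_algebra.
From mathcomp Require Import complex.
From mathcomp Require Import boolp classical_sets reals trigo.

Set Implicit Arguments.
Unset Strict Implicit.
Unset Printing Implicit Defensive.

Import Order.TTheory GRing.Theory Num.Theory.
Local Open Scope ring_scope.
Local Open Scope complex_scope.

Definition incr_tuples (n j : nat) : {set j.-tuplelexi 'I_n} :=
  [set t : j.-tuplelexi 'I_n | sorted ltn (map val t)].

Lemma card_incr_tuples (n j : nat) : #|incr_tuples n j| = 'C(n, j).
Proof. exact: card_ltn_sorted_tuples. Qed.

(* [Order.enum_val] is monotone for a total order, so this numbers the tuples i_1 < ... < i_j
   in the lexicographic order carried by [tuplelexi]. *)
Definition incr_tuple (n j : nat) (a : 'I_'C(n, j)) : j.-tuple 'I_n :=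
  @Order.enum_val _ _ (mem (incr_tuples n j))
    (cast_ord (esym (card_incr_tuples n j)) a).

Definition compound (R : comPzRingType) (n j : nat) (A : 'M[R]_n) :
    'M[R]_'C(n, j) :=
  \matrix_(a, b) \det (mxsub (tnth (incr_tuple a)) (tnth (incr_tuple b)) A).

Definition strictly_J_sign_symmetric (R : numDomainType) (N : nat)
    (B : 'M[R]_N) : Prop :=
  (forall i j, B i j != 0) /\
  exists J : {set 'I_N}, forall i j, B i j < 0 <-> (i \in J) (+) (j \in J).

Definition J_sign_symmetric (R : numDomainType) (N : nat)
    (B : 'M[R]_N) : Prop :=
  exists J : {set 'I_N},
    (forall i j, (i \in J) (+) (j \in J) -> B i j <= 0) /\
    (forall i j, B i j < 0 -> (i \in J) (+) (j \in J)).

Definition J_sign_symmetric_primitive (R : numDomainType) (N : nat)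
    (B : 'M[R]_N) : Prop :=
  J_sign_symmetric B /\
  exists m : nat, (1 <= m)%N /\ strictly_J_sign_symmetric (B ^+ m).

Definition complexify (R : realType) (n : nat) (A : 'M[R]_n) : 'M[R[i]]_n :=
  map_mx (real_complex R) A.

Definition alg_mult (R : realType) (n : nat) (A : 'M[R]_n) (z : R[i]) : nat :=
  mup z (char_poly (complexify A)).

Definition spectral_radius (R : realType) (n : nat) (A : 'M[R]_n) : R :=
  sup [set Normc.normc z | z in [set z | eigenvalue (complexify A) z]]%classic.

(* The eigenvalues are [lam 1], ..., [lam n]; the other values of [lam] are
   irrelevant. *)
Definition eigenvalue_numbering (R : realType) (n : nat) (A : 'M[R]_n)
    (lam : nat -> R[i]) : Prop :=
  (forall z, count_mem z [seq lam i | i <- iota 1 n] = alg_mult A z) /\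
  (forall i, (1 <= i)%N -> (i.+1 <= n)%N ->
     Normc.normc (lam i.+1) <= Normc.normc (lam i)).

(* Principal value in ]-pi, pi]; meaningful only for [z != 0]. *)
Definition arg (R : realType) (z : R[i]) : R :=
  let t := acos (complex.Re z / Normc.normc z) in if 0 <= complex.Im z then t else - t.

Definition eq_mod_2pi (R : realType) (s t : R) : Prop :=
  exists k : int, s = t + (2 * pi) *~ k.

(* Main.v *)
(* By Cauchy-Binet, the eigenvalues of the [j]th compound matrix are the products of
   [j] eigenvalues of [A] with distinct indices. A signature similarity makes a
   J-sign-symmetric primitive matrix nonnegative and primitive, so by Perron's theorem
   it has an algebraically simple positive eigenvalue that strictly dominates all the
   others in modulus. For odd [j] the product of the [j] largest eigenvalues is
   therefore positive and strictly larger in modulus than the product in which the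
   [j]th factor is replaced by the [(j+1)]th: this gives the gaps, and the quotient of
   the products for [j] and [j+2] shows that the product of the eigenvalues numbered
   [j+1] and [j+2] is positive. *)

Require Import Defs.
From mathcomp Require Import all_boot all_order all_algebra.
From mathcomp Require Import fingroup perm complex.
From mathcomp Require Import boolp classical_sets reals trigo.
From mathcomp Require Import topology normedtype derive.
From mathcomp Require Import ring lra zify.

Set Implicit Arguments.
Unset Strict Implicit.
Unset Printing Implicit Defensive.

Import Order.TTheory GRing.Theory Num.Theory.
Import numFieldNormedType.Exports.
Local Open Scope ring_scope.
Local Open Scope complex_scope.

(** * Triangularization *)

Lemma char_poly_conj (F : fieldType) n (V A T : 'M[F]_n) :
  V \in unitmx -> V *m A = T *m V -> char_poly A = char_poly T.
Proof.
move=> Vu VA; have Vp : \det (map_mx polyC V) != 0.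
  by rewrite det_map_mx polyC_eq0 -unitfE -unitmxE.
apply: (mulfI Vp); rewrite [RHS]mulrC -!det_mulmx /char_poly_mx.
congr (\det _); rewrite mulmxBr mulmxBl -!map_mxM VA.
by rewrite mul_mx_scalar mul_scalar_mx.
Qed.

Lemma is_trig_mxM (R : comNzRingType) n (A B : 'M[R]_n) :
  is_trig_mx A -> is_trig_mx B -> is_trig_mx (A *m B).
Proof.
move=> /is_trig_mxP At /is_trig_mxP Bt; apply/is_trig_mxP => i k ik.
rewrite mxE big1// => j _; have [ij|ji] := ltnP i j.
  by rewrite At// mul0r.
by rewrite Bt ?mulr0// (leq_ltn_trans ji).
Qed.

Lemma trig_mxM_diag (R : comNzRingType) n (A B : 'M[R]_n) i :
  is_trig_mx A -> is_trig_mx B -> (A *m B) i i = A i i * B i i.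
Proof.
move=> /is_trig_mxP At /is_trig_mxP Bt.
rewrite mxE (bigD1 i)//= big1 ?addr0// => j; rewrite neq_ltn => /orP[ji|ij].
  by rewrite Bt ?mulr0.
by rewrite At ?mul0r.
Qed.

Lemma trig_mxX (R : comNzRingType) n (A : 'M[R]_n) m : is_trig_mx A ->
  is_trig_mx (A ^+ m) /\ forall i, (A ^+ m) i i = A i i ^+ m.
Proof.
move=> At; elim: m => [|m [IHt IHd]].
  rewrite expr0; split=> [|i]; first exact: scalar_mx_is_trig.
  by rewrite expr0 mxE eqxx.
rewrite exprS; split=> [|i]; first exact: is_trig_mxM.
by rewrite [LHS]trig_mxM_diag// IHd exprS.
Qed.

Lemma unitmx_row0 (F : fieldType) n (v : 'rV[F]_n.+1) :
  v != 0 -> exists2 g : 'M_n.+1, g \in unitmx & row 0 g = v.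
Proof.
move=> v0; pose e : 'rV[F]_n.+1 := delta_mx 0 0.
have ev : e *m (e^T *m v) = v.
  by rewrite mulmxA trmx_delta mul_delta_mx (_ : delta_mx 0 0 = 1%:M) ?mul1mx//;
     apply/matrixP => i j; rewrite !ord1 !mxE.
have [|g gu eg] := @complete_unitmx F 1 n.+1 e (e^T *m v).
  by rewrite ev !rank_rV v0; congr (nat_of_bool _); apply/esym/eqP => /matrixP
     /(_ 0 0)/eqP; rewrite !mxE /= oner_eq0.
by exists g => //; rewrite rowE -eg.
Qed.

(* Unlike in the library's [Schur], the order of the diagonal is prescribed. *)
Lemma trigonalize (F : fieldType) n (A : 'M[F]_n) (l : 'I_n -> F) :
  char_poly A = \prod_i ('X - (l i)%:P) ->
  exists V T : 'M[F]_n, [/\ V \in unitmx, V *m A = T *m V, is_trig_mx T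
    & forall i, T i i = l i].
Proof.
elim: n => [|n IHn] in A l *.
  by move=> _; exists 1%:M, A; split;
     [exact: unitmx1|rewrite mul1mx mulmx1|apply/is_trig_mxP => -[]|case].
(* A left eigenvector for [l 0] becomes the first row of [g], so the first row of [B = g A g^-1] is
   [(l 0, 0, ..., 0)]; induction handles the lower right block. *)
move=> cA; have: eigenvalue A (l 0).
  by rewrite eigenvalue_root_char cA big_ord_recl rootM root_XsubC eqxx.
case/eigenvalueP => v vA /unitmx_row0[g gu gv].
pose B : 'M_(1 + n) := g *m A *m invmx g.
have gA : g *m A = B *m g by rewrite mulmxKV.
have B0 j : B ord0 j = l 0 *+ (j == ord0).
  have /rowP/(_ j) : row ord0 B = l 0 *: row ord0 1%:M.
    by rewrite !row_mul gv vA -scalemxAl -gv -row_mul mulmxV.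
  by rewrite !mxE mulr_natr eq_sym.
have BE : B = block_mx (l 0)%:M 0 (dlsubmx B) (drsubmx B).
  rewrite -[LHS](@submxK _ 1 n 1 n); congr block_mx; apply/matrixP => i j.
    have l0 k : lshift n (k : 'I_1) = ord0 by rewrite ord1; apply: val_inj.
    by rewrite 2!mxE !l0 B0 mxE !ord1.
  have l0 k : lshift n (k : 'I_1) = ord0 by rewrite ord1; apply: val_inj.
  by rewrite 2!mxE l0 B0 mxE.
have cB : char_poly (drsubmx B) = \prod_(i < n) ('X - (l (lift ord0 i))%:P).
  have := char_poly_conj gu gA; rewrite cA big_ord_recl [in char_poly B]BE => /esym.
  rewrite /char_poly /char_poly_mx (map_block_mx polyC) map_scalar_mx/= map_mx0.
  rewrite (@scalar_mx_block _ 1 n) opp_block_mx add_block_mx oppr0 addr0.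
  rewrite det_lblock -raddfB det_scalar1; apply: mulfI.
  by rewrite polyXsubC_eq0.
have [V [T [Vu VB Tt Td]]] := IHn _ _ cB.
pose W : 'M_(1 + n) := block_mx 1%:M 0 0 V.
have Wu : W \in unitmx by rewrite unitmxE det_lblock det1 mul1r -unitmxE.
pose T1 : 'M_(1 + n) := block_mx (l 0)%:M 0 (V *m dlsubmx B) T.
have WB : W *m B = T1 *m W.
  rewrite [in LHS]BE /W /T1 !mulmx_block.
  by rewrite !mul1mx !mul0mx !mulmx0 !mulmx1 !add0r !addr0 VB.
exists (W *m g), T1; split.
- by rewrite unitmx_mul Wu.
- by rewrite -mulmxA gA mulmxA WB -mulmxA.
- by rewrite (@is_trig_block_mx _ 1 n 1 n)// eqxx scalar_mx_is_trig.
- move=> i; rewrite -(@splitK 1 n i); case: split => j /=.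
    by rewrite (@block_mxEul _ 1 n 1 n) !ord1 mxE; congr l; apply: val_inj.
  by rewrite (@block_mxEdr _ 1 n 1 n) Td; congr l; apply: val_inj.
Qed.

Lemma char_poly_expmx (F : fieldType) n (A : 'M[F]_n) (l : 'I_n -> F) m :
  char_poly A = \prod_i ('X - (l i)%:P) ->
  char_poly (A ^+ m) = \prod_i ('X - (l i ^+ m)%:P).
Proof.
move=> /trigonalize[V [T [Vu VA Tt Td]]].
have VAm : V *m A ^+ m = T ^+ m *m V.
  elim: m => [|m IHm]; first by rewrite !expr0 mul1mx mulmx1.
  rewrite !exprS -[A * _]/(A *m _) -[T * _]/(T *m _).
  by rewrite -[RHS]mulmxA -IHm mulmxA VA mulmxA.
have [Tmt Tmd] := trig_mxX m Tt.
rewrite (char_poly_conj Vu VAm) (char_poly_trig Tmt).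
by apply: eq_bigr => i _; rewrite Tmd Td.
Qed.

(** * Compound matrices *)

Lemma incr_tupleP n j (a : 'I_'C(n, j)) :
  {homo tnth (incr_tuple a) : i k / (i < k)%N}.
Proof.
have: incr_tuple a \in incr_tuples n j by exact: Order.enum_valP.
rewrite inE => srt i k ik; have ij := ltn_ord i; have kj := ltn_ord k.
have n0 : (0 < n)%N by apply: leq_trans (ltn_ord (tnth (incr_tuple a) i)).
pose x := Ordinal n0; rewrite !(tnth_nth x) -!(nth_map x 0%N) ?size_tuple//.
by apply: (sorted_ltn_nth ltn_trans) => //; rewrite inE size_map size_tuple.
Qed.

Lemma incr_tuple_inj n j : injective (@incr_tuple n j).
Proof. move=> a b ab; apply: (@cast_ord_inj _ _ (esym (card_incr_tuples n j))).
exact: (@Order.enum_val_inj _ _ (mem (incr_tuples n j))). Qed.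

Lemma incr_tuple_onto n j (t : j.-tuple 'I_n) :
  {homo tnth t : i k / (i < k)%N} -> exists a, incr_tuple a = t.
Proof.
move=> tinc; have tin : (t : j.-tuplelexi 'I_n) \in incr_tuples n j.
  rewrite inE; case: n => [|n] in t tinc *.
    by case: j t tinc => [|j] t; [rewrite tuple0|case: (tnth t ord0)].
  apply/(sortedP 0%N) => i; rewrite size_map size_tuple => ij.
  rewrite !(nth_map ord0) ?size_tuple//; last exact: ltnW.
  by have := tinc (Ordinal (ltnW ij)) (Ordinal ij) (ltnSn _);
     rewrite !(tnth_nth ord0).
exists (cast_ord (card_incr_tuples n j) (Order.enum_rank_in tin t)).
by rewrite /incr_tuple cast_ordK Order.enum_rankK_in.
Qed.

(** The first position where the tuples differ is such a [k]. This is what makes the compound of a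
    triangular matrix triangular. *)
Lemma incr_tuple_lex n j (a b : 'I_'C(n, j)) : (a < b)%N ->
  exists k : 'I_j, (tnth (incr_tuple a) k < tnth (incr_tuple b) k)%N.
Proof.
move=> ab; have: ((incr_tuple a : j.-tuplelexi 'I_n) < incr_tuple b)%O.
  by rewrite ltNge Order.le_enum_val ?leEord -?ltnNge//; exact: le_total.
by case/Order.TupleLexiOrder.ltxi_tuplePlt => k _ kk; exists k.
Qed.

(** Multilinearity: row [i] of [A B] combines the rows of [B] with coefficients [A i _], and [f]
    picks one of these rows for each [i]. *)
Lemma det_mulmx_ffun (R : comPzRingType) j n (A : 'M[R]_(j, n)) (B : 'M_(n, j)) :
  \det (A *m B) =
  \sum_(f : {ffun 'I_j -> 'I_n}) (\prod_i A i (f i)) * \det (rowsub f B).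
Proof.
pose AB (s : 'S_j) i k := A i k * B k (s i).
transitivity (\sum_(f : {ffun 'I_j -> 'I_n}) \sum_(s : 'S_j)
    (-1) ^+ s * \prod_i AB s i (f i)).
  rewrite exchange_big; apply: eq_bigr => /= s _; rewrite -big_distrr /=.
  congr (_ * _); rewrite -(bigA_distr_bigA (AB s)) /=.
  by apply: eq_bigr => x _; rewrite mxE.
apply: eq_bigr => f _; rewrite big_distrr/=; apply: eq_bigr => s _.
rewrite mulrCA big_split; congr (_ * (_ * _)).
by apply: eq_bigr => i _; rewrite mxE.
Qed.

(* Every injection ['I_j -> 'I_n] is, in a unique way, an increasing tuple
   precomposed with a permutation. *)
Lemma sum_inj_ffun (R : nmodType) j n (G : {ffun 'I_j -> 'I_n} -> R) :
  \sum_(f : {ffun 'I_j -> 'I_n} | injectiveb f) G f =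
  \sum_(a : 'I_'C(n, j)) \sum_(s : 'S_j)
     G [ffun i => tnth (incr_tuple a) (s i)].
Proof.
pose h (p : 'I_'C(n, j) * 'S_j) : {ffun 'I_j -> 'I_n} :=
  [ffun i => tnth (incr_tuple p.1) (p.2 i)].
have tinj (a : 'I_'C(n, j)) : injective (tnth (incr_tuple a)).
  move=> i k e; apply/val_inj/eqP; case: ltngtP => // /(incr_tupleP a).
    by rewrite e ltnn.
  by rewrite e ltnn.
have hinj : injective h.
  move=> [a s] [b t] /ffunP e.
  have ab : a = b.
    apply: incr_tuple_inj; apply: val_inj; apply: (inj_map val_inj).
    apply: (irr_sorted_eq ltn_trans ltnn).
    - have: incr_tuple a \in incr_tuples n j by exact: Order.enum_valP.
      by rewrite inE.
    - have: incr_tuple b \in incr_tuples n j by exact: Order.enum_valP.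
      by rewrite inE.
    apply: eq_mem_map => x; apply/tnthP/tnthP => -[i ->].
      by exists (t (s^-1 i)%g); have := e (s^-1 i)%g; rewrite !ffunE/= permKV.
    by exists (s (t^-1 i)%g); have := e (t^-1 i)%g; rewrite !ffunE/= permKV.
  rewrite ab in e *; congr (_, _); apply/permP => i.
  by have := e i; rewrite !ffunE/= => /tinj.
rewrite pair_big/=.
transitivity (\sum_(f in h @: [set: _]%SET) G f); last first.
  rewrite big_imset/=; last by move=> p q _ _ /hinj.
  by apply: eq_bigl => p; rewrite inE.
suff -> : h @: [set: _]%SET = [set f : {ffun _} | injectiveb f].
  by apply: eq_bigl => f; rewrite inE.
apply/eqP; rewrite eqEcard; apply/andP; split.
  apply/fintype.subsetP => _ /imsetP[p _ ->]; rewrite inE; apply/injectiveP => i k.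
  by rewrite !ffunE => /tinj/perm_inj.
rewrite card_inj_ffuns card_imset// !card_ord -bin_ffact.
by rewrite finset.cardsT card_prod card_ord -card_Sn.
Qed.

(** In the multilinear expansion a non-injective [f] repeats a row of [B] and contributes 0. The
    injective ones are grouped by image: sorting the rows of [B] costs the sign of [s], and the sum
    over [s] rebuilds the minor of [A]. *)
Lemma cauchy_binet (R : comPzRingType) j n (A : 'M[R]_(j, n)) (B : 'M_(n, j)) :
  \det (A *m B) = \sum_(a : 'I_'C(n, j))
    \det (colsub (tnth (incr_tuple a)) A) * \det (rowsub (tnth (incr_tuple a)) B).
Proof.
rewrite det_mulmx_ffun (bigID (fun f : {ffun _} => injectiveb f))/=.
rewrite [X in _ + X]big1 ?addr0 => [|f /injectivePn[i [k ik fik]]]; last first.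
  rewrite (determinant_alternate ik) ?mulr0// => l.
  by rewrite !mxE fik.
rewrite sum_inj_ffun; apply: eq_bigr => a _.
rewrite [in RHS]/determinant big_distrl/=; apply: eq_bigr => s _.
rewrite (_ : rowsub _ B = row_perm s (rowsub (tnth (incr_tuple a)) B)).
  rewrite row_permE det_mulmx det_perm mulrCA mulrA; congr (_ * _ * _).
  by apply: eq_bigr => i _; rewrite mxE ffunE.
by apply/matrixP => i k; rewrite !mxE ffunE.
Qed.

Lemma compoundM (R : comPzRingType) n j (A B : 'M[R]_n) :
  compound j (A *m B) = compound j A *m compound j B.
Proof.
apply/matrixP => a b; rewrite !mxE.
rewrite (_ : mxsub _ _ _ = rowsub (tnth (incr_tuple a)) A *m
                           colsub (tnth (incr_tuple b)) B); last first.
  by apply/matrixP => i k; rewrite !mxE; apply: eq_bigr => l _; rewrite !mxE.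
rewrite cauchy_binet; apply: eq_bigr => c _; rewrite !mxE.
by congr (_ * _); congr (\det _); apply/matrixP => i k; rewrite !mxE.
Qed.

Lemma map_compound (R S : comPzRingType) (f : {rmorphism R -> S}) n j
  (A : 'M[R]_n) : map_mx f (compound j A) = compound j (map_mx f A).
Proof.
apply/matrixP => a b; rewrite !mxE -det_map_mx; congr (\det _).
by apply/matrixP => i k; rewrite !mxE.
Qed.

Lemma compound_trig (R : comPzRingType) n j (T : 'M[R]_n) : is_trig_mx T ->
  is_trig_mx (compound j T) /\ forall a : 'I_'C(n, j),
    compound j T a a = \prod_k T (tnth (incr_tuple a) k) (tnth (incr_tuple a) k).
Proof.
move=> /is_trig_mxP Tt; split=> [|a]; last first.
  rewrite mxE det_trig; first by apply: eq_bigr => k _; rewrite mxE.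
  by apply/is_trig_mxP => i k /(incr_tupleP a) ik; rewrite mxE Tt.
apply/is_trig_mxP => a b /incr_tuple_lex[k ltk]; rewrite mxE.
(* The entries in rows [<= k] and columns [>= k] vanish. *)
rewrite /determinant big1// => s _.
(* Pigeonhole: the injective [s] cannot send the [k.+1] indices [<= k] into the [k] indices [< k],
   so every term of the expansion contains a vanishing entry. *)
have [i ik ki] : exists2 i : 'I_j, (i <= k)%N & (k <= s i)%N.
  apply/exists_inP; apply: contraT; rewrite negb_exists_in => /forall_inP si.
  have /subset_leq_card : s @: [set i : 'I_j | (i <= k)%N] \subset
                          [set i : 'I_j | (i < k)%N].
    apply/fintype.subsetP => _ /imsetP[y + ->].
    by rewrite !inE ltnNge; exact: si.
  rewrite card_imset; last exact: perm_inj.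
  suff -> : [set i : 'I_j | (i <= k)%N] = k |: [set i : 'I_j | (i < k)%N].
    by rewrite cardsU1 inE ltnn add1n ltnn.
  by apply/setP => i; rewrite !inE leq_eqVlt.
have mono (c : 'I_'C(n, j)) : {homo tnth (incr_tuple c) : x y / (x <= y)%N}.
  move=> x y; rewrite leq_eqVlt => /orP[/eqP/val_inj->//|/(incr_tupleP c)].
  exact: ltnW.
rewrite (bigD1 i)//= mxE Tt ?(mul0r, mulr0)//.
by apply: leq_ltn_trans (mono _ _ _ ik) (leq_trans ltk (mono _ _ _ ki)).
Qed.

(** By multiplicativity the compound of [V] conjugates the compound of [A] to that of [T], which is
    triangular with these products on its diagonal. *)
Lemma char_poly_compound (F : fieldType) n j (A : 'M[F]_n) (l : 'I_n -> F) :
  char_poly A = \prod_i ('X - (l i)%:P) ->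
  char_poly (compound j A) =
  \prod_(a : 'I_'C(n, j)) ('X - (\prod_k l (tnth (incr_tuple a) k))%:P).
Proof.
move=> /trigonalize[V [T [Vu VA Tt Td]]].
have cVA : compound j V *m compound j A = compound j T *m compound j V.
  by rewrite -!compoundM VA.
have cVu : compound j V \in unitmx.
  rewrite unitmxE unitfE.
  have [c1t c1d] := compound_trig j (scalar_mx_is_trig n (1 : F)).
  have d1 : \det (compound j V) * \det (compound j (invmx V)) = 1.
    rewrite -det_mulmx -compoundM mulmxV// det_trig// big1// => a _.
    by rewrite c1d big1// => k _; rewrite mxE eqxx.
  by apply: contra_eqN d1 => /eqP->; rewrite mul0r eq_sym oner_eq0.
have [cTt cTd] := compound_trig j Tt.
rewrite (char_poly_conj cVu cVA) (char_poly_trig cTt).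
by apply: eq_bigr => a _; rewrite cTd; congr ('X - _%:P); apply: eq_bigr.
Qed.

(** * Perron's theorem *)

Lemma mulmx_row_gt0 (R : numDomainType) m n (x : 'rV[R]_m) (P : 'M_(m, n)) j :
  (forall i k, 0 < P i k) -> (forall i, 0 <= x 0 i) -> x != 0 ->
  0 < (x *m P) 0 j.
Proof.
move=> P0 x0 xN0; rewrite lt0r mxE sumr_ge0 ?andbT => [|i _]; last first.
  by rewrite mulr_ge0// ltW.
apply: contra xN0; rewrite psumr_eq0 => [/allP xP|i _]; last first.
  by rewrite mulr_ge0// ltW.
apply/eqP/rowP => i; rewrite mxE; apply/eqP; have := xP i (mem_index_enum _).
by rewrite mulf_eq0 (gt_eqF (P0 _ _)) orbF.
Qed.

Lemma bigmin_continuous_at (R : realType) (T : topologicalType) I (s : seq I)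
    (g0 : T -> R) (g : I -> T -> R) (x : T) :
  {for x, continuous g0} -> (forall i, {for x, continuous (g i)}) ->
  {for x, continuous (fun y => \big[Num.min/g0 y]_(i <- s) g i y)}.
Proof.
move=> c0 cg; elim: s => [|i s IHs].
  rewrite (_ : (fun _ => _) = g0)//.
  by apply/funext => y; rewrite big_nil.
rewrite (_ : (fun _ => _) = g i \min (fun y => \big[Num.min/g0 y]_(i <- s) g i y)).
  exact: continuous_min.
by apply/funext => y; rewrite big_cons.
Qed.

Lemma row_mulmx_continuous (R : realType) m n (P : 'M[R]_(m, n)) j :
  continuous (fun x : 'rV[R]_m => (x *m P) 0 j).
Proof.
have -> : (fun x : 'rV[R]_m => (x *m P) 0 j) = fun x => \sum_i x 0 i * P i j.
  by apply/funext => x; rewrite mxE.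
apply: continuous_big => [|i _ x]; first exact: add_continuous.
by apply: continuousM; [exact: coord_continuous|exact: cst_continuous].
Qed.

(** Writing the simplex inside the box [[0, 1]^n] exhibits it as a closed subset of a product of
    compact segments. *)
Lemma simplex_compact (R : realType) n :
  compact [set x : 'rV[R]_n |
    (forall i, `[0, 1]%classic (x 0 i)) /\ \sum_i x 0 i = 1]%classic.
Proof.
have box := rV_compact (fun _ : 'I_n => @segment_compact R 0 1).
apply: (subclosed_compact _ box) => [|x []//].
apply: closedI; first exact: compact_closed (@norm_hausdorff _ _) box.
apply: (@preimage_closed _ _ (fun x : 'rV[R]_n => \sum_i x 0 i) [set 1]%classic).
  move=> x _; apply: continuous_big => [|i _]; first exact: add_continuous.
  exact: coord_continuous.
exact: closed_eq.
Qed.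

(* A maximiser of the Collatz-Wielandt function [min_j (xP^2)_j / (xP)_j] over the
   simplex: if [y = xP] were not an eigenvector, [yP] would do strictly better. *)
Lemma perron_vector (R : realType) n (P : 'M[R]_n.+1) :
  (forall i j, 0 < P i j) -> exists (r : R) (x : 'rV_n.+1),
    [/\ 0 < r, forall i, 0 < x 0 i & x *m P = r *: x].
Proof.
move=> P0; set K := [set x : 'rV[R]_n.+1 |
    (forall i, `[0, 1]%classic (x 0 i)) /\ \sum_i x 0 i = 1]%classic.
have KP x j : K x -> 0 < (x *m P) 0 j.
  move=> [x01 xs]; apply: mulmx_row_gt0 => // [i|].
    by have := x01 i; rewrite /= in_itv/= => /andP[].
  apply: contra_eq_neq xs => ->; rewrite big1 => [|i _]; last by rewrite mxE.
  by rewrite eq_sym oner_neq0.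
(* The ratios compare [x P^2] with [x P] rather than [x P] with [x]: [x P] is positive on all of
   [K], while [x] may have zero entries. The default [q 0 x] in [f] is itself a ratio, so [f x] is
   exactly their minimum. *)
pose q j (x : 'rV[R]_n.+1) := (x *m P *m P) 0 j / (x *m P) 0 j.
pose f x := \big[Num.min/q 0 x]_(j < n.+1) q j x.
have cf : {within K, continuous f}%classic.
  apply: continuous_in_subspaceT => x /set_mem Kx.
  have cq j : {for x, continuous (q j)}.
    apply: continuousM; last apply: continuousV.
    - rewrite (_ : (fun _ => _) = (fun x : 'rV_n.+1 => (x *m (P *m P)) 0 j)).
        exact: row_mulmx_continuous.
      by apply/funext => z; rewrite mulmxA.
    - by rewrite gt_eqF// KP.
    - exact: row_mulmx_continuous.
  exact: bigmin_continuous_at.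
have normK (y : 'rV[R]_n.+1) : (forall i, 0 < y 0 i) -> K ((\sum_i y 0 i)^-1 *: y).
  move=> y0; have s0 : 0 < \sum_i y 0 i.
    by rewrite big_ord_recl ltr_pwDl// sumr_ge0// => i _; rewrite ltW.
  split=> [i|]; last first.
    under eq_bigr do rewrite mxE.
    by rewrite -mulr_sumr mulVf// gt_eqF.
  rewrite /= in_itv/= mxE mulrC; apply/andP; split.
    by rewrite divr_ge0// ltW.
  rewrite ler_pdivrMr// mul1r.
  by rewrite (bigD1 i)//= lerDl sumr_ge0// => k _; exact: ltW.
have K0 : (K !=set0)%classic.
  exists ((\sum_i (const_mx 1 : 'rV[R]_n.+1) 0 i)^-1 *: const_mx 1).
  by apply: normK => i; rewrite mxE ltr01.
have [x /set_mem Kx fmax] := EVT_max_rV K0 (@simplex_compact R n.+1) cf.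
pose y := x *m P.
have y0 j : 0 < y 0 j by exact: KP.
have ry j : f x * y 0 j <= (y *m P) 0 j.
  by rewrite -ler_pdivlMr//; exact: bigmin_le.
move: (f x) fmax ry => r fmax ry; clearbody y.
have yE : y *m P = r *: y.
  apply/eqP; rewrite -subr_eq0; apply: contraT => wN0; exfalso.
  (* The difference is nonnegative and nonzero, so multiplying by [P] makes all its entries
     positive; hence every ratio [q j] at the rescaled [y] exceeds the maximum [r]. *)
  have w0 j : 0 < ((y *m P - r *: y) *m P) 0 j.
    by apply: mulmx_row_gt0 => // i; have := ry i; rewrite !mxE subr_ge0.
  have := fmax _ (mem_set (normK _ y0)); apply/negP; rewrite -ltNge.
  have qr j : r < q j ((\sum_i y 0 i)^-1 *: y).
    have s0 : (\sum_i y 0 i)^-1 != 0.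
      rewrite invr_eq0 gt_eqF// big_ord_recl ltr_pwDl// sumr_ge0// => i _.
      exact: ltW.
    rewrite /q -!scalemxAl !mxE -mulf_div divff// mul1r ltr_pdivlMr; last first.
      by have := mulmx_row_gt0 j P0 (fun i => ltW (y0 i)); rewrite mxE; apply;
         apply: contraTneq (y0 0) => ->; rewrite mxE ltxx.
    have := w0 j; rewrite mulmxBl -scalemxAl.
    by rewrite [X in 0 < X]mxE [X in _ + X]mxE [X in _ - X]mxE subr_gt0 !mxE.
  by apply/bigmin_gtP; split=> // j _; exact: qr.
exists r, y; split=> //.
have: 0 < (y *m P) 0 0.
  apply: mulmx_row_gt0 => // [i|]; first exact: ltW.
  by apply: contraTneq (y0 0) => ->; rewrite mxE ltxx.
by rewrite yE mxE pmulr_lgt0.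
Qed.

(** The bordered matrix [M] is reduced in two ways: column operations give [det (a - v x)], and row
    operations of determinant [a] give the right side. The factor [a] on the left avoids dividing by
    [a]. *)
Lemma det_scalar_sub_rank1 (R : comPzRingType) n (v : 'cV[R]_n) (x : 'rV_n) a :
  a * \det (a%:M - v *m x) = a ^+ n * (a - (x *m v) 0 0).
Proof.
pose M := block_mx a%:M v x 1%:M : 'M_(n + 1).
have E1 : \det M = \det (a%:M - v *m x).
  have := det_mulmx M (block_mx 1%:M 0 (- x) 1%:M).
  rewrite mulmx_block !mulmx1 !mulmx0 !add0r mul1mx mulmxN addrN.
  by rewrite det_ublock det_lblock !det1 !mulr1.
have := det_mulmx (block_mx 1%:M 0 (- x) a%:M) M.
rewrite mulmx_block !mul1mx !mul0mx !addr0 mulmx1 mulNmx.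
rewrite mul_mx_scalar mul_scalar_mx addNr det_lblock det1 mul1r det_scalar1.
rewrite E1 => <-; rewrite det_ublock det_scalar; congr (_ * _).
by rewrite det_mx11 mxE [a%:M _ _]mxE eqxx mulr1n addrC (mulNmx x) [in LHS]mxE.
Qed.

(* Brauer: a rank-one update along a left eigenvector moves only its eigenvalue. *)
Lemma char_poly_rank1 (F : fieldType) n (Q : 'M[F]_n) (v : 'cV_n) (x : 'rV_n) s :
  x *m Q = s *: x ->
  ('X - s%:P) * char_poly (Q + v *m x) =
  ('X - (s + (x *m v) 0 0)%:P) * char_poly Q.
Proof.
move=> xQ; set a := 'X - s%:P; have a0 : a != 0 by rewrite polyXsubC_eq0.
apply: (mulfI (expf_neq0 n a0)); set M := char_poly_mx Q.
pose v' := map_mx polyC v; pose x' := map_mx polyC x.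
have xM : x' *m M = a *: x'.
  rewrite mulmxBr -map_mxM xQ map_mxZ mul_mx_scalar scalerBl.
  by congr (_ - _ *: _).
have PE : char_poly_mx (Q + v *m x) = M - v' *m x'.
  by rewrite /char_poly_mx map_mxD opprD addrA map_mxM.
(* Since [x' M = a x'], the factor [M] can be pulled out on the right; determinants then reduce the
   claim to [det (a - v' x')]. *)
have aP : a *: char_poly_mx (Q + v *m x) = (a%:M - v' *m x') *m M.
  by rewrite PE scalerBr mulmxBl mul_scalar_mx -mulmxA xM -scalemxAr.
have := congr1 determinant aP; rewrite detZ det_mulmx => dP.
rewrite mulrCA -/(char_poly _) dP mulrA det_scalar_sub_rank1 -mulrA.
congr (_ * (_ * _)); rewrite /a -map_mxM mxE polyCD opprD addrA.
by [].
Qed.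

(* If [xP = rx], then [Q = P - vx >= 0], with [v] a small constant column, still has
   [x > 0] as an eigenvector, for [s = r - xv < r]. So the spectrum of [Q] lies in the
   disc of radius [s], and by [char_poly_rank1] the spectrum of [P] is that of [Q]
   with [s] replaced by [r]. *)
Lemma perron_dominant (R : realType) n (P : 'M[R]_n.+1) (d : 'I_n.+1 -> R[i]) :
  (forall i j, 0 < P i j) -> char_poly (complexify P) = \prod_i ('X - (d i)%:P) ->
  exists2 k, 0 < d k & forall i, i != k -> `|d i| < d k.
Proof.
move=> P0 cP; have [r [x [r0 x0 xP]]] := perron_vector P0.
(* Small enough for [Q = P - v x] to stay nonnegative; the default 1 keeps the minimum positive. *)
pose e := \big[Num.min/1]_(p : 'I_n.+1 * 'I_n.+1) (P p.1 p.2 / x 0 p.2).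
have e0 : 0 < e by apply/bigmin_gtP; split=> // p _; rewrite divr_gt0.
have eP i j : e * x 0 j <= P i j.
  by rewrite -ler_pdivlMr//;
     exact: (@bigmin_le _ _ _ 1 (i, j) (fun p => P p.1 p.2 / x 0 p.2)).
pose v : 'cV[R]_n.+1 := const_mx e; pose Q := P - v *m x.
have Q0 i j : 0 <= Q i j by rewrite !mxE big_ord1 !mxE subr_ge0.
pose t := (x *m v) 0 0; pose s := r - t.
have t0 : 0 < t.
  rewrite /t mxE big_ord_recl ltr_pwDl// ?sumr_ge0// => [|i _].
    by rewrite mxE mulr_gt0.
  by rewrite mxE mulr_ge0// ltW.
have xQ : x *m Q = s *: x.
  by rewrite mulmxBr mulmxA [x *m v]mx11_scalar mul_scalar_mx xP -scalerBl.
have [ds cQ] := closed_field_poly_normal (char_poly (complexify Q)).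
rewrite (monicP (char_poly_monic _)) scale1r in cQ.
have rt : s + (x *m v) 0 0 = r by rewrite /s /t subrK.
have PQ : ('X - (s%:C)%:P) * \prod_i ('X - (d i)%:P) =
          ('X - (r%:C)%:P) * \prod_(z <- ds) ('X - z%:P).
  rewrite -cP -cQ /complexify -!map_char_poly.
  have := congr1 (map_poly (real_complex R)) (char_poly_rank1 v xQ).
  by rewrite rt subrK !rmorphM/= !map_polyXsubC.
have sr : s < r by rewrite /s ltrBlDr ltrDl.
have rs : r%:C != s%:C by rewrite eq_complex/= eqxx andbT gt_eqF.
have dsP z : z \in ds -> `|z| <= s%:C.
  rewrite -root_prod_XsubC -cQ -eigenvalue_root_char => /eigenvalueP[y yQ y0].
  (* The index [j] maximises [|y i| / x i], so [|y i| <= g j * x i] for all [i]. Comparing entry [j]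
     of [y Q = z y] with that of [x Q = s x] then gives [|z| <= s]. *)
  pose g i := Normc.normc (y 0 i) / x 0 i.
  have [j _ jmax] := @arg_maxP _ _ _ ord0 xpredT g isT.
  have xj i : `|y 0 i| <= (g j * x 0 i)%:C by rewrite lecR -ler_pdivrMr//; exact: jmax.
  have yj : `|y 0 j| = (g j * x 0 j)%:C by rewrite divfK// gt_eqF.
  have gj : 0 < (g j * x 0 j)%:C.
    rewrite -yj normr_gt0; apply: contra y0 => /eqP yj0.
    have gj0 : g j = 0 by rewrite /g yj0 Normc.normc0 mul0r.
    apply/eqP/rowP => i; rewrite mxE; apply/eqP; rewrite -normr_le0.
    by have := xj i; rewrite gj0 mul0r.
  rewrite -(ler_pM2r gj) -{1}yj -normrM.
  have -> : z * y 0 j = \sum_i y 0 i * (Q i j)%:C.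
    have /rowP/(_ j) := yQ; rewrite !mxE => <-.
    by apply: eq_bigr => i _; rewrite mxE.
  apply: le_trans (ler_norm_sum _ _ _) _.
  have -> : s%:C * (g j * x 0 j)%:C = \sum_i (g j * x 0 i)%:C * (Q i j)%:C.
    have /rowP/(_ j) := xQ; rewrite !mxE => sx.
    rewrite -rmorphM mulrCA -sx mulr_sumr rmorph_sum.
    by apply: eq_bigr => i _; rewrite -rmorphM mulrA.
  apply: ler_sum => i _; rewrite normrM.
  have Qc : 0 <= (Q i j)%:C by rewrite ler0c.
  by rewrite (ger0_norm Qc) ler_wpM2r.
(* [r] is a root of the right side of [PQ] and differs from [s], so it is some [d k]; cancelling
   [X - r] makes every other [d i] an eigenvalue of [Q]. *)
have : root (('X - (s%:C)%:P) * \prod_i ('X - (d i)%:P)) r%:C.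
  by rewrite PQ rootM root_XsubC eqxx.
rewrite rootM root_XsubC (negbTE rs)/=.
rewrite -(big_map d predT (fun z => 'X - z%:P)) root_prod_XsubC => /mapP[k _ rk].
exists k; first by rewrite -rk ltcR.
move=> i ik; rewrite -rk; apply: le_lt_trans (_ : s%:C < _); last by rewrite ltcR.
apply: dsP; rewrite -root_prod_XsubC.
move: PQ; rewrite (bigD1 k)//= -rk mulrCA => /mulfI <-; last by rewrite polyXsubC_eq0.
by rewrite rootM (bigD1 i)//= rootM !root_XsubC eqxx orbT.
Qed.

(* A signature matrix [D] turns [B] into [C = DBD >= 0] with [C^m, C^(m+1) > 0].
   Both powers are dominated by the same index [k], and [d k] is positive because
   [d k ^ m] and [d k ^ m.+1] are. *)
Lemma J_primitive_dominant (R : realType) N (B : 'M[R]_N) (d : 'I_N -> R[i]) :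
  (0 < N)%N -> J_sign_symmetric_primitive B ->
  char_poly (complexify B) = \prod_i ('X - (d i)%:P) ->
  exists2 k, 0 < d k & forall i, i != k -> `|d i| < `|d k|.
Proof.
case: N B d => // n B d _ [[J [J1 J2]] [m [m0 [Bm0 _]]]] cB.
pose sg (i : 'I_n.+1) : R := (-1) ^+ (i \in J).
pose D := diag_mx (\row_i sg i); pose C := D *m B *m D.
have DD : D *m D = 1%:M.
  rewrite /D mulmx_diag -diag_const_mx; congr diag_mx; apply/rowP => i.
  by rewrite !mxE -expr2 sqrr_sign.
have CE i j : C i j = sg i * sg j * B i j.
  by rewrite /C /D mul_mx_diag mxE mul_diag_mx !mxE mulrAC.
have C0 i j : 0 <= C i j.
  rewrite CE /sg -signr_addb; have [/J1|] := boolP (_ (+) _).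
    by rewrite expr1 mulN1r oppr_ge0.
  rewrite expr0 mul1r; case: (ltP (B i j) 0) => // /J2 -> //.
have DC : D *m B = C *m D by rewrite /C -mulmxA DD mulmx1.
have CX p : C ^+ p = D *m (B ^+ p) *m D.
  elim: p => [|p IHp]; first by rewrite !expr0 mulmx1 DD.
  rewrite !exprS -[C * _]/(C *m _) IHp -[B * _]/(B *m _) !mulmxA.
  by rewrite -DC.
have CX0 p i j : 0 <= (C ^+ p) i j.
  elim: p => [|p IHp] in i j *; first by rewrite expr0 mxE ler0n.
  by rewrite exprS mxE sumr_ge0// => k _; rewrite mulr_ge0.
have Cm i j : 0 < (C ^+ m) i j.
  rewrite lt0r CX0 andbT CX /D mul_mx_diag mxE mul_diag_mx !mxE.
  by rewrite !mulf_neq0// ?signr_eq0.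
have Cm1 i j : 0 < (C ^+ m.+1) i j.
  rewrite exprS -[C * _]/(C *m _).
  suff -> : (C *m C ^+ m) i j = (row i C *m C ^+ m) 0 j.
    apply: mulmx_row_gt0 => // [k|]; first by rewrite mxE.
    (* If row [i] of [C] were zero, so would be row [i] of [C^m], because [m >= 1]; this contradicts
       [Cm]. *)
    apply: contraTneq (Cm i j) => Ci0.
    case: m m0 {Bm0 Cm} => // p _.
    have /rowP/(_ j) : row i (C ^+ p.+1) = 0 by rewrite exprS row_mul Ci0 mul0mx.
    by rewrite !mxE => ->; rewrite ltxx.
  by rewrite -row_mul [RHS]mxE.
have cC : char_poly (complexify C) = \prod_i ('X - (d i)%:P).
  rewrite -cB /complexify -!map_char_poly; congr map_poly.
  by apply/esym/(char_poly_conj _ DC); case: (mulmx1_unit DD).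
have cCX p : char_poly (complexify (C ^+ p)) = \prod_i ('X - (d i ^+ p)%:P).
  rewrite -(char_poly_expmx p cC) /complexify; congr char_poly.
  elim: p => [|p IHp]; first by rewrite !expr0 map_mx1.
  by rewrite !exprS -[C * _]/(C *m _) map_mxM IHp.
have [k1 k1P k1d] := perron_dominant Cm (cCX m).
have [k2 k2P k2d] := perron_dominant Cm1 (cCX m.+1).
have norm_lt p i j : (0 < p)%N -> 0 < d j ^+ p -> `|d i ^+ p| < d j ^+ p ->
    `|d i| < `|d j|.
  move=> p0 jp; rewrite -(gtr0_norm jp) !normrX.
  by rewrite (ltr_pXn2r p0)// nnegrE.
have k12 : k1 = k2.
  apply/eqP; apply: contraT => k12.
  have := norm_lt _ _ _ m0 k1P (k1d k2 _); rewrite eq_sym k12 => /(_ isT) lt1.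
  have := norm_lt _ _ _ (ltn0Sn m) k2P (k2d k1 k12).
  by move=> /(lt_trans lt1); rewrite ltxx.
exists k1 => [|i ik]; last exact: norm_lt m0 k1P (k1d i ik).
by move: k2P; rewrite -k12 exprSr pmulr_rgt0.
Qed.

(** * Eigenvalues in order of modulus *)

Lemma incr_tuple_ge n j (a : 'I_'C(n, j)) (k : 'I_j) :
  (k <= tnth (incr_tuple a) k)%N.
Proof.
case: k => k; elim: k => // k IHk kj; apply: leq_ltn_trans (IHk (ltnW kj)) _.
exact: (@incr_tupleP _ _ a (Ordinal (ltnW kj)) (Ordinal kj)).
Qed.

(* Among the products of [j] distinct eigenvalues, the dominant one is
   [l 0 * ... * l j.-1]; comparing it with [l 0 * ... * l j.-2 * l j] gives the gap. *)
Lemma odd_compound_gap (R : realType) n (A : 'M[R]_n) (l : nat -> R[i]) j :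
  J_sign_symmetric_primitive (compound j A) -> (0 < j <= n)%N ->
  char_poly (complexify A) = \prod_(i < n) ('X - (l i)%:P) ->
  (forall i k, (i <= k < n)%N -> `|l k| <= `|l i|) ->
  0 < \prod_(i < j) l i /\ ((j < n)%N -> `|l j| < `|l j.-1|).
Proof.
case: j => // j Aj /= jn cA lmono.
pose d (a : 'I_'C(n, j.+1)) := \prod_k l (tnth (incr_tuple a) k).
have cAj : char_poly (complexify (compound j.+1 A)) = \prod_a ('X - (d a)%:P).
  rewrite -(char_poly_compound j.+1 cA); congr char_poly.
  exact: map_compound.
have Nj : (0 < 'C(n, j.+1))%N by rewrite bin_gt0.
have [k k0 kmax] := J_primitive_dominant Nj Aj cAj.
have [b0 b0E] : exists b, incr_tuple b = [tuple widen_ord jn i | i < j.+1].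
  by apply: incr_tuple_onto => x y; rewrite !tnth_mktuple.
have d0 : d b0 = \prod_(i < j.+1) l i.
  by apply: eq_bigr => i _; rewrite b0E tnth_mktuple.
have b0k : b0 = k.
  (* The initial tuple [b0] bounds every other product factor by factor, since entry [i] of an
     increasing tuple is at least [i]; so the strictly dominant index must be [b0]. *)
  apply/eqP; apply: contraT => /kmax/lt_geF <-.
  rewrite !normr_prod; apply: ler_prod => i _; rewrite normr_ge0/=.
  by apply: lmono; rewrite b0E tnth_mktuple ltn_ord andbT; exact: incr_tuple_ge.
rewrite -b0k d0 in k0 kmax; split=> // jn'.
(* The tuple [(0, ..., j-1, j+1)]: the initial one with its last entry raised by one. *)
pose t1 (i : 'I_j.+1) : 'I_n := if (i < j)%N then widen_ord jn i else Ordinal jn'.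
have [b1 b1E] : exists b, incr_tuple b = [tuple t1 i | i < j.+1].
  apply: incr_tuple_onto => x y xy; rewrite !tnth_mktuple /t1.
  have xj : (x < j)%N by apply: leq_trans xy _; rewrite -ltnS.
  by rewrite xj; case: ifP => _ //=; exact: ltnW.
have d1 : d b1 = (\prod_(i < j) l i) * l j.+1.
  rewrite /d big_ord_recr b1E; congr (_ * _).
    by apply: eq_bigr => i _; rewrite tnth_mktuple /t1/= ltn_ord.
  by rewrite tnth_mktuple /t1/= ltnn.
have b10 : b1 != b0.
  apply/eqP => /(congr1 (fun b => tnth (incr_tuple b) ord_max)).
  rewrite b1E b0E !tnth_mktuple /t1/= ltnn => /(congr1 val)/= /eqP.
  by rewrite (gtn_eqF (ltnSn j)).
have := kmax _ b10.
rewrite d1 big_ord_recr/= !normrM ltr_pM2l//.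
rewrite normr_gt0; apply: contraTneq k0 => p0.
by rewrite big_ord_recr/= p0 mul0r ltxx.
Qed.

(** The listed values and the roots of the characteristic polynomial occur with the same
    multiplicities, hence are permutations of each other. *)
Lemma numbering_char_poly (R : realType) n (A : 'M[R]_n) (lam : nat -> R[i]) :
  eigenvalue_numbering A lam ->
  char_poly (complexify A) = \prod_(i < n) ('X - (lam i.+1)%:P).
Proof.
move=> [cnt _].
have -> : \prod_(i < n) ('X - (lam i.+1)%:P) =
          \prod_(z <- [seq lam i | i <- iota 1 n]) ('X - z%:P).
  by rewrite big_map -(big_mkord xpredT (fun i => 'X - (lam i.+1)%:P))
             -(big_add1 _ _ 0%N n.+1 xpredT (fun i => 'X - (lam i)%:P))
             /index_iota subn1.
have [s cA] := closed_field_poly_normal (char_poly (complexify A)).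
rewrite (monicP (char_poly_monic _)) scale1r in cA.
rewrite cA; apply: perm_big; apply/allP => z _; apply/eqP.
by rewrite /= cnt /alg_mult cA mu_prod_XsubC.
Qed.

Lemma numbering_mono (R : realType) n (A : 'M[R]_n) (lam : nat -> R[i]) i k :
  eigenvalue_numbering A lam -> (0 < i <= k)%N -> (k <= n)%N ->
  Normc.normc (lam k) <= Normc.normc (lam i).
Proof.
move=> [_ mono] /andP[i0]; elim: k => [|k IHk]; first by rewrite leqNgt i0.
rewrite leq_eqVlt => /orP[/eqP<-//|ik kn].
by apply: le_trans (mono _ (leq_trans i0 ik) kn) (IHk ik (ltnW kn)).
Qed.

(** The multiplicity bound mentions no numbering, so its proof has to produce one: the roots sorted
    by modulus. *)
Lemma numbering_exists (R : realType) n (A : 'M[R]_n) :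
  exists lam, eigenvalue_numbering A lam.
Proof.
have [s cA] := closed_field_poly_normal (char_poly (complexify A)).
rewrite (monicP (char_poly_monic _)) scale1r in cA.
pose r (z w : R[i]) := Normc.normc w <= Normc.normc z.
have r_total : total r by move=> z w; exact: le_total.
pose t := sort r s; pose lam i := nth 0 t i.-1.
have st : size t = n.
  have := size_char_poly (complexify A).
  by rewrite cA size_prod_XsubC size_sort => -[].
exists lam; split=> [z|i i0 ik]; last first.
  have := sort_sorted r_total s => /(sortedP 0)/(_ i.-1).
  by rewrite (prednK i0) -/t st; apply.
have -> : [seq lam i | i <- iota 1 n] = t.
  by rewrite (iotaDl 1 0) -map_comp -[RHS](mkseq_nth 0) st.
by rewrite /alg_mult cA mu_prod_XsubC; 
   move: (pred1 z); apply/seq.permP; rewrite perm_sort.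
Qed.

(** If [z w > 0], then [w] is the conjugate of [z] times [|w| / |z|]: the cosines agree and the
    imaginary parts have opposite signs. *)
Lemma arg_conj (R : realType) (z w : R[i]) :
  0 < z * w -> eq_mod_2pi (arg w) (- arg z).
Proof.
move=> zw; have zw0 := lt0r_neq0 zw.
have z0 : z != 0 by apply: contraNneq zw0 => ->; rewrite mul0r.
have w0 : w != 0 by apply: contraNneq zw0 => ->; rewrite mulr0.
have normc_gt0 (x : R[i]) : x != 0 -> 0 < Normc.normc x.
  by rewrite -normr_gt0 ltcR.
have nz := normc_gt0 _ z0; have nw := normc_gt0 _ w0.
have nzw : Normc.normc z * Normc.normc w = complex.Re (z * w).
  by rewrite -Normc.normcM; have := gtr0_norm zw => /(congr1 (@complex.Re R)).
have nz2 : Normc.normc z ^+ 2 = complex.Re z ^+ 2 + complex.Im z ^+ 2.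
  by case: (z) => a b; rewrite /= sqr_sqrtr// addr_ge0// sqr_ge0.
move: zw; rewrite ltcE/= => /andP[/eqP Im0 Re0].
rewrite /arg /eq_mod_2pi.
move: (Normc.normc z) (Normc.normc w) nz nw nzw nz2 => p q p0 q0.
case: z w {z0 w0 zw0} Im0 Re0 => a b [x y] /= Im0 Re0 pq p2.
(* Coordinates of [w |z|^2 = conj(z) (z w)], with [p = |z|] and [z w = p q]. *)
have xE : x * p ^+ 2 = a * (p * q).
  by have : b * (a * y + b * x) = 0; [rewrite Im0 mulr0|rewrite p2 pq; lra].
have yE : y * p ^+ 2 = - b * (p * q).
  by have : a * (a * y + b * x) = 0; [rewrite Im0 mulr0|rewrite p2 pq; lra].
have <- : a / p = x / q.
  apply/eqP; rewrite eqr_div ?(lt0r_neq0 p0) ?(lt0r_neq0 q0)//; apply/eqP.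
  apply: (mulIf (lt0r_neq0 p0)).
  by rewrite -[RHS]mulrA -expr2 xE; ring.
have yb : (0 <= y) = (b <= 0).
  rewrite -(pmulr_lge0 y (exprn_gt0 2 p0)) yE.
  by rewrite pmulr_lge0 ?mulr_gt0// oppr_ge0.
rewrite yb; case: (ltgtP b 0) => b0.
- by exists 0; rewrite opprK mulr0z addr0.
- by exists 0; rewrite mulr0z addr0.
(* In the real case both arguments are 0 or both are [pi]; the latter needs [k = 1], as
   [pi = - pi + 2 pi]. *)
have : a ^+ 2 = p ^+ 2 by rewrite p2 b0 expr0n addr0.
move=> /eqP; rewrite eqf_sqr => /orP[]/eqP ->.
  by exists 0; rewrite divff ?gt_eqF// acos1 oppr0 mulr0z addr0.
by exists 1; rewrite mulNr divff ?gt_eqF// acosN1 mulr1z mulr_natl mulr2n addKr.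
Qed.

Theorem theorem8 (R : realType) (n : nat) (n_gt0 : (0 < n)%N) (A : 'M[R]_n)
    (hA : forall j : nat, odd j -> (1 <= j <= n)%N ->
       J_sign_symmetric_primitive (compound j A)) :
  (forall z : R[i], eigenvalue (complexify A) z -> (alg_mult A z <= 2)%N) /\
  (forall lam : nat -> R[i], eigenvalue_numbering A lam ->
    [/\ spectral_radius A = Normc.normc (lam 1%N) /\
        (forall i : nat, odd i -> (i.+1 <= n)%N ->
           Normc.normc (lam i.+1) < Normc.normc (lam i)),
        [/\ lam 1%N = (spectral_radius A)%:C,
            0 < spectral_radius A,
            eigenvalue (complexify A) (lam 1%N)
          & alg_mult A (lam 1%N) = 1%N],
        ~~ odd n -> complex.Im (lam n) = 0
      & forall i : nat, (0 < i)%N -> ~~ odd i -> (i.+1 <= n)%N ->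
          [/\ lam i != 0, lam i.+1 != 0
            & eq_mod_2pi (arg (lam i.+1)) (- arg (lam i))]]).
Proof.
have gap lam j : eigenvalue_numbering A lam -> odd j -> (j <= n)%N ->
    0 < \prod_(i < j) lam i.+1 /\
    ((j < n)%N -> Normc.normc (lam j.+1) < Normc.normc (lam j)).
  move=> num oj jn; have j0 : (0 < j)%N by case: (j) oj.
  have [||i k ikn|p0 lt] := @odd_compound_gap R n A (fun i => lam i.+1) j
    (hA j oj _) _ (numbering_char_poly num).
  - by rewrite j0.
  - by rewrite j0.
  - by rewrite lecR; apply: (numbering_mono num); lia.
  by split=> // /lt; rewrite ltcR (prednK j0).
split=> [z _|lam num].
  have [lam num] := numbering_exists A.
  rewrite -num.1 count_map -size_filter; set s := seq.filter _ _.
  have sP i : i \in s -> [/\ lam i = z, (0 < i)%N & (i <= n)%N].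
    rewrite mem_filter mem_iota add1n ltnS => /andP[/eqP zi /andP[i0 ni]].
    by split.
  have s_uniq : uniq s by rewrite filter_uniq ?iota_uniq.
  (* Equal eigenvalues cannot sit on both sides of a strict gap at an odd index. *)
  have half_le i k : i \in s -> k \in s -> (k./2 <= i./2)%N.
    move=> /sP[iz i0 ni] /sP[kz k0 nk]; rewrite leqNgt; apply/negP => ik.
    (* The least odd index [m >= i]; [i./2 < k./2] places [k] beyond it. *)
    pose m := (i./2).*2.+1.
    have mk : (m < k)%N by rewrite /m; lia.
    have im : (i <= m)%N by rewrite /m; lia.
    have mn : (m < n)%N by exact: leq_trans mk nk.
    have [|_ /(_ mn) lt] := gap lam m num _ (ltnW mn).
      by rewrite /m/= odd_double.
    have lek : Normc.normc (lam k) <= Normc.normc (lam m.+1).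
      exact: (numbering_mono num).
    have lei : Normc.normc (lam m) <= Normc.normc (lam i).
      by apply: (numbering_mono num); rewrite ?i0//; exact: ltnW.
    have := le_lt_trans lek (lt_le_trans lt lei).
    by rewrite iz kz ltxx.
  case: s => [|i s] // in sP s_uniq half_le *.
  (* All indices carrying [z] have the same half, so they lie among two consecutive numbers. *)
  apply: (@uniq_leq_size _ _ [:: (i./2).*2; (i./2).*2.+1]) => // k ks.
  have := half_le i k (mem_head _ _) ks; have := half_le k i ks (mem_head _ _).
  by rewrite !inE; lia.
have chA := numbering_char_poly num.
have eigP z : eigenvalue (complexify A) z <-> exists2 i, (0 < i <= n)%N & z = lam i.
  rewrite eigenvalue_root_char chA.
  rewrite -(big_map (fun i : 'I_n => lam i.+1) predT (fun z => 'X - z%:P)).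
  rewrite root_prod_XsubC; split=> [/mapP[i _ ->]|[[//|i] /= ni ->]].
    by exists i.+1; rewrite ?ltn_ord.
  by apply/mapP; exists (Ordinal ni); rewrite ?mem_index_enum.
have sr : spectral_radius A = Normc.normc (lam 1%N).
  have eig1 : eigenvalue (complexify A) (lam 1%N) by apply/eigP; exists 1%N.
  have ub1 : ubound [set Normc.normc z | z in
      [set z | eigenvalue (complexify A) z]]%classic (Normc.normc (lam 1%N)).
    move=> _ [z /eigP[i /andP[i0 ni] ->] <-]; exact: (numbering_mono num).
  apply/eqP; rewrite eq_le; apply/andP; split.
    by apply: ge_sup => //; exists (Normc.normc (lam 1%N)), (lam 1%N).
  by apply: ub_le_sup; [exists (Normc.normc (lam 1%N))|exists (lam 1%N)].
have [lam1 _] := gap lam 1%N num isT n_gt0; rewrite big_ord1 in lam1.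
have lam1E : lam 1%N = (Normc.normc (lam 1%N))%:C by rewrite -[LHS]gtr0_norm.
split.
- by split=> // i oi ni; have [_ /(_ ni)] := gap lam i num oi (ltnW ni).
- rewrite sr; split=> //; first by rewrite -ltcR -lam1E.
    by apply/eigP; exists 1%N.
  (* An index [k >= 2] with [lam k = lam 1] would violate the gap between [lam 1] and [lam 2]. *)
  rewrite -num.1 (_ : iota 1 n = 1%N :: iota 2 n.-1); last by case: (n) n_gt0.
  rewrite /= eqxx (count_memPn _)//; apply/mapP => -[k].
  rewrite mem_iota => /andP[k2 nk] lam1k.
  have n1 : (1 < n)%N by lia.
  have [_ /(_ n1)] := gap lam 1%N num isT n_gt0; rewrite lam1k ltNge => /negP[].
  by apply: (numbering_mono num); lia.
(* As [n.-1] is odd, the product of the first [n.-1] eigenvalues is positive; times [lam n] it is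
   the real number [det A], so [lam n] is real. *)
- move=> en; have [|p0 _] := gap lam n.-1 num _ (leq_pred n).
    by case: (n) n_gt0 en => //= k _; rewrite negbK.
  have detE : (\prod_(i < n.-1) lam i.+1) * lam n = \det (complexify A).
    have /(congr1 (fun p => p.[0])) := chA.
    rewrite horner_coef0 char_poly_det horner_prod.
    under eq_bigr do rewrite hornerXsubC sub0r.
    rewrite prodrN card_ord => /mulrI -> //.
      by rewrite -[in RHS](prednK n_gt0) big_ord_recr/= prednK.
    by rewrite unitrX// unitrN unitr1.
  have : lam n \is Num.real.
    rewrite -[lam n](mulKf (lt0r_neq0 p0)) detE det_map_mx.
    by rewrite rpredM ?rpredV ?(gtr0_real p0)//; apply/complex_realP; exists (\det A).
  by case: (lam n) => x y; rewrite complex_real => /eqP.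
- move=> i i0 ei ni.
  have [|p0 _] := gap lam i.-1 num _ (leq_trans (leq_pred i) (ltnW ni)).
    by case: (i) i0 ei => //= k _; rewrite negbK.
  have [p1 _] := gap lam i.+1 num ei ni.
  (* Quotient of the positive products of the first [i.+1] and [i.-1] eigenvalues. *)
  have zw : 0 < lam i * lam i.+1.
    move: p1; rewrite -(prednK i0) !big_ord_recr/= -mulrA.
    by rewrite pmulr_rgt0.
  have := lt0r_neq0 zw; rewrite mulf_eq0 negb_or => /andP[-> ->].
  by split=> //; exact: arg_conj.
Qed.
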